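(* Let $n\geq 3$ and $k\geq 1$ be integers, let $K$ be a field, and let $R=K[V(T_{n,k})]$. Then the Castelnuovo-Mumford regularity of $R/I(T_{n,k})$ is $$\operatorname{reg}(R/I(T_{n,k}))=\begin{cases}\dfrac{n(n-1)^{k+1}-n(n-1)}{(n-1)^{3}-1}, & \text{if } k\equiv 0 \pmod 3;\\[2mm] \dfrac{n(n-1)^{k+1}-(n-1)^{2}-1}{(n-1)^{3}-1}, & \text{if } k\equiv 1 \pmod 3;\\[2mm] \dfrac{n(n-1)^{k+1}-n}{(n-1)^{3}-1}, & \text{if } k\equiv 2 \pmod 3.\end{cases}$$
   Context: For a finite simple graph $G$, $K[V(G)]$ denotes the polynomial ring over $K$ whose variables are the vertices of $G$, and the edge ideal $I(G)\subset K[V(G)]$ is the ideal generated by the monomials $xy$ with $\{x,y\}$ an edge of $G$. Perfect semiregular tree $T_{n,k}$: the rooted tree in which all non-pendant vertices (vertices of degree $\neq 1$) have degree $n$ and all pendant vertices (leaves) are at distance $k$ from the root. Explicitly, the root has $n$ children, every other non-leaf vertex has exactly $n-1$ children, and all leaves are at distance $k$ from the root. Regularity: for a finitely generated graded module $M$ over a (standard graded) polynomial ring with graded Betti numbers $\beta_{i,j}(M)$, $\operatorname{reg}(M)=\max\{j-i:\beta_{i,j}(M)\neq 0\}$. *)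

(* Defs.v *)
From HB Require Import structures.
From mathcomp Require Import all_boot all_order all_algebra.
From mathcomp Require Import mpoly.

Set Implicit Arguments.
Unset Strict Implicit.
Unset Printing Implicit Defensive.

Import Order.TTheory GRing.Theory Num.Theory.
Local Open Scope ring_scope.

Record sgraph := SGraph {
  vertex : finType;
  edge : rel vertex;
  edge_sym : ssrbool.symmetric edge;
  edge_irrefl : irreflexive edge
}.

(* A vertex is the word of the choices made along the path from the root: the
   first letter is one of the n children of the root, every later letter is
   one of the n - 1 children of a vertex other than the root.  The root is the
   empty word, the length of a word is its distance to the root, and the
   leaves are the words of the maximal length k. *)
Definition tree_vertex (n k : nat) : finType :=
  {w : k.-bseq 'I_n | all (fun a : 'I_n => (a < n.-1)%N) (behead w)}.

Definition is_child (n k : nat) (u v : tree_vertex n k) : bool :=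
  [exists a : 'I_n, (val v : seq 'I_n) == rcons (val u) a].

Definition tree_edge (n k : nat) : rel (tree_vertex n k) :=
  fun u v => is_child u v || is_child v u.

Lemma tree_edge_sym (n k : nat) : ssrbool.symmetric (@tree_edge n k).
Proof. by move=> u v; rewrite /tree_edge orbC. Qed.

Lemma tree_edge_irrefl (n k : nat) : irreflexive (@tree_edge n k).
Proof.
move=> u; rewrite /tree_edge orbb; apply/existsP => -[a /eqP].
by move/(congr1 size); rewrite size_rcons; apply: n_Sn.
Qed.

Definition semiregular_tree (n k : nat) : sgraph :=
  SGraph (@tree_edge_sym n k) (@tree_edge_irrefl n k).

Definition ideal_generated (R : comNzRingType) (S : R -> Prop) (p : R) : Prop :=
  exists s : seq (R * R),
    (forall c, c \in s -> S c.2) /\ p = \sum_(c <- s) c.1 * c.2.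

(* K[V(G)], its variables being numbered by [enum_rank]. *)
Notation vertex_ring K G := {mpoly K[#|vertex G|]}.

Definition vertex_var (K : fieldType) (G : sgraph) (v : vertex G) :
  vertex_ring K G := 'X_(enum_rank v).

Definition edge_ideal (K : fieldType) (G : sgraph) : vertex_ring K G -> Prop :=
  ideal_generated (fun p =>
    exists u v : vertex G, edge u v /\ p = vertex_var K u * vertex_var K v).

Arguments vertex_var K {G} v.
Arguments edge_ideal K G : clear implicits.

Section Resolutions.
Variables (K : fieldType) (N : nat).
Notation R := {mpoly K[N]}.

(* Homogeneous of degree d for an integer d; when d < 0 only 0 qualifies. *)
Definition homogz (d : int) (p : R) : Prop :=
  forall m, m \in msupp p -> (mdeg m)%:Z = d.

(* Free modules F_i = \bigoplus_a R(- shift i a), whose elements are row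
   vectors; the differential F_(i+1) -> F_i is v |-> v *m diff i.  The
   augmentation F_0 -> R/I is given by representatives in R of the images of
   the basis vectors. *)
Record free_complex := FreeComplex {
  rk : nat -> nat;
  shift : forall i, 'I_(rk i) -> int;
  diff : forall i, 'M[R]_(rk i.+1, rk i);
  aug : 'cV[R]_(rk 0)
}.
Arguments shift F {i} a : rename.

(* The maps of the complex are homogeneous of degree 0. *)
Definition graded_complex (F : free_complex) : Prop :=
  (forall i a b, homogz (shift F a - shift F b) (diff F i a b)) /\
  (forall a, homogz (shift F a) (aug F a 0)).

(* Exactness of ... -> F_2 -> F_1 -> F_0 -> R/I -> 0, at R/I, at F_0 and at
   each F_(i+1). *)
Definition resolves_quotient (I : R -> Prop) (F : free_complex) : Prop :=
  [/\ forall p : R, exists v : 'rV_(rk F 0), I (p - (v *m aug F) 0 0),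
      forall v : 'rV_(rk F 0),
        I ((v *m aug F) 0 0) <-> exists w, v = w *m diff F 0
    & forall i (v : 'rV_(rk F i.+1)),
        v *m diff F i = 0 <-> exists w, v = w *m diff F i.+1].

(* The image of each differential lies in (x_1, ..., x_N) F_i. *)
Definition minimal_complex (F : free_complex) : Prop :=
  forall i a b, (diff F i a b)@_0%MM = 0.

Definition minimal_graded_free_resolution (I : R -> Prop) (F : free_complex) :
  Prop :=
  [/\ graded_complex F, resolves_quotient I F & minimal_complex F].

(* beta_(i,j)(R/I) = b *)
Definition graded_betti_number (I : R -> Prop) (i : nat) (j : int) (b : nat) :
  Prop :=
  exists F, minimal_graded_free_resolution I F /\
    b = #|[set a : 'I_(rk F i) | shift F a == j]|.

(* reg(R/I) = r *)
Definition regularity_quotient (I : R -> Prop) (r : int) : Prop :=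
  (exists i j b, [/\ graded_betti_number I i j b, b != 0%N & j - i%:Z = r]) /\
  (forall i j b, graded_betti_number I i j b -> b != 0%N -> j - i%:Z <= r).

Lemma regularity_quotient_unique (I : R -> Prop) (r s : int) :
  regularity_quotient I r -> regularity_quotient I s -> r = s.
Proof.
move=> [[i [j [b [Hb b0 <-]]]] max1] [[i' [j' [b' [Hb' b0' <-]]]] max2].
by apply/le_anti; rewrite (max2 _ _ _ Hb b0) (max1 _ _ _ Hb' b0').
Qed.

End Resolutions.

(* Main.v *)
(* Let x be a deepest non-isolated vertex of a forest, so that x has a single
   neighbour y.  Then I(G) = I(G - x) + (xy), and I(G - x) : xy is generated by
   the other neighbours of y and by I(G - N[y]).  The comparison map of the
   resulting mapping cone lifts multiplication by xy, hence can be taken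
   divisible by x, so the cone is a minimal resolution and
   reg(G) = max(reg(G - x), reg(G - N[y]) + 1).  The induced matching number
   satisfies the same recursion, so it is the regularity.  In T_(n,k) a maximum
   induced matching has one edge from each vertex of depth d < k with
   d = k - 1 mod 3 to a child; counting these vertices gives the formula. *)
Require Import Defs.
From mathcomp Require Import all_boot all_order all_algebra.
From mathcomp Require Import mpoly ring zify.
From Stdlib Require Import IndefiniteDescription.
Import Order.TTheory GRing.Theory Num.Theory.
Local Open Scope ring_scope.

Set Implicit Arguments.
Unset Strict Implicit.
Unset Printing Implicit Defensive.

(** The invariant [Q] travels with each term in a subset type, so the recursion can always continue.
    Comparison maps are built this way, one homological degree at a time. *)
Lemma dependent_choice_nat (A : nat -> Type) (Q : forall i, A i -> Prop)
    (P : forall i, A i -> A i.+1 -> Prop) (a0 : A 0) :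
  Q 0 a0 ->
  (forall i a, Q i a -> exists b, P i a b /\ Q i.+1 b) ->
  exists f : forall i, A i,
    [/\ f 0 = a0, forall i, Q i (f i) & forall i, P i (f i) (f i.+1)].
Proof.
move=> Qa0 step.
have next i (a : {a : A i | Q i a}) :
    {b : {b : A i.+1 | Q i.+1 b} | P i (sval a) (sval b)}.
  case: a => a Qa.
  have /constructive_indefinite_description[b [Pb Qb]] := step i a Qa.
  by exists (exist _ b Qb).
pose g := fix g i : {a : A i | Q i a} :=
  if i is j.+1 then sval (next j (g j)) else exist _ a0 Qa0.
exists (fun i => sval (g i)); split=> // i; first exact: (svalP (g i)).
exact: (svalP (next i (g i))).
Qed.

(** * Homogeneous components of polynomials, in integer degrees *)

Section Homogeneous.
Variables (K : fieldType) (N : nat).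
Notation R := {mpoly K[N]}.
Implicit Types (p q : R) (d e : int).

(** Degrees are integers because differences of shifts can be negative; the component is then 0, in
    agreement with [homogz]. *)
Definition homog_part d p : R :=
  if d is Posz k then pihomog mdeg k p else 0.

Lemma homog_partD d p q : homog_part d (p + q) = homog_part d p + homog_part d q.
Proof. by case: d => k /=; rewrite ?addr0 // linearD. Qed.

Lemma homog_partN d p : homog_part d (- p) = - homog_part d p.
Proof. by case: d => k /=; rewrite ?oppr0 // linearN. Qed.

Lemma homog_partZ d c p : homog_part d (c *: p) = c *: homog_part d p.
Proof. by case: d => k /=; rewrite ?scaler0 // linearZ. Qed.

Lemma homog_part0 d : homog_part d 0 = 0.
Proof. by case: d => k //=; rewrite linear0. Qed.

Lemma homog_part_sum d (I : Type) (r : seq I) (P : pred I) (f : I -> R) :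
  homog_part d (\sum_(i <- r | P i) f i) = \sum_(i <- r | P i) homog_part d (f i).
Proof. by apply: (big_morph _ (homog_partD d) (homog_part0 d)). Qed.

Lemma homog_part_homogz d p : homogz d (homog_part d p).
Proof.
case: d => k m /=; last by rewrite msupp0.
by have /dhomogP hp := pihomogP mdeg k p => /hp ->.
Qed.

Lemma homog_part_id d p : homogz d p -> homog_part d p = p.
Proof.
case: d => k hp /=.
  by apply/pihomog_dE/dhomogP => m /hp [].
by rewrite (@msuppnil0 _ _ p) //; case s: (msupp p) => [|m t] //;
   have := hp m; rewrite s mem_head => /(_ isT).
Qed.

Lemma homog_part_neq d e p : homogz e p -> d != e -> homog_part d p = 0.
Proof.
case: d => // k hp ke /=; rewrite pihomogE big1_seq // => m /andP[/eqP mk mp].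
by move: ke; rewrite -(hp _ mp) mk eqxx.
Qed.

Lemma msupp_homog_part d p : {subset msupp (homog_part d p) <= msupp p}.
Proof.
case: d => k m /=; last by rewrite msupp0.
move=> /msupp_sum_le /flattenP[s /mapP[m']]; rewrite mem_filter => /andP[_ pm' ->].
by move=> /msuppZ_le; rewrite msuppX inE => /eqP ->.
Qed.

Lemma homogz0 d : homogz d (0 : R).
Proof. by move=> m; rewrite msupp0. Qed.

Lemma homogzM d e p q : homogz d p -> homogz e q -> homogz (d + e) (p * q).
Proof.
move=> hp hq m /msuppM_le /allpairsP[[m1 m2] /= [/hp h1 /hq h2 ->]].
by rewrite mdegD PoszD h1 h2.
Qed.

Lemma homogzX m : homogz (mdeg m) ('X_[m] : R).
Proof. by move=> m'; rewrite msuppX inE => /eqP ->. Qed.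

Lemma homogz1 : homogz 0 (1 : R).
Proof. by rewrite -mpolyX0 => m /homogzX; rewrite mdeg0. Qed.

Lemma homogzD d p q : homogz d p -> homogz d q -> homogz d (p + q).
Proof. by move=> hp hq m /msuppD_le; rewrite mem_cat => /orP[/hp|/hq]. Qed.

Lemma homogzN d p : homogz d p -> homogz d (- p).
Proof. by move=> hp m; rewrite (perm_mem (msuppN p)) => /hp. Qed.

Lemma homogz_const d p : homogz d p -> p@_0%MM != 0 -> d = 0.
Proof. by move=> hp; rewrite -mcoeff_msupp => /hp <-; rewrite mdeg0. Qed.

(** By linearity [p] may be taken to be a monomial. Its product with [q] is homogeneous, and both
    sides keep it or kill it together. *)
Lemma homog_partM d e p q :
  homogz e q -> homog_part d (p * q) = homog_part (d - e) p * q.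
Proof.
move=> hq; rewrite (mpolyE p) mulr_suml !homog_part_sum mulr_suml.
apply: eq_bigr => m _; rewrite -scalerAl !homog_partZ -scalerAl; congr (_ *: _).
have hm := @homogzX m.
have [/eqP dE|dE] := eqVneq d ((mdeg m)%:Z + e).
  rewrite homog_part_id; last by rewrite (eqP dE); apply: homogzM.
  by rewrite (homog_part_id (d := d - e)) // (eqP dE) addrK.
rewrite (homog_part_neq (homogzM hm hq) dE) (homog_part_neq hm) ?mul0r //.
by rewrite subr_eq.
Qed.

(** Each coefficient of an arbitrary solution is replaced by its component of the required degree.
    The entries of [D] being homogeneous, this commutes with multiplication by [D], so the equations
    survive. *)
Lemma homogeneous_solution (a b c : nat) (s : 'I_a -> int) (t : 'I_b -> int)
    (u : 'I_c -> int) (M : 'M[R]_(a, b)) (D : 'M[R]_(c, b)) :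
  (forall i j, homogz (s i - t j) (M i j)) ->
  (forall i j, homogz (u i - t j) (D i j)) ->
  (forall v, exists w : 'rV_c, row v M = w *m D) ->
  exists W : 'M_(a, c),
    M = W *m D /\ forall i j, homogz (s i - u j) (W i j).
Proof.
move=> hM hD sol.
have [w wE] : exists w : 'I_a -> 'rV_c, forall v, row v M = w v *m D.
  exact: (fin_all_exists (U := fun=> 'rV_c)) sol.
exists (\matrix_(i, j) homog_part (s i - u j) (w i 0 j)); split; last first.
  by move=> i j; rewrite mxE; apply: homog_part_homogz.
apply/matrixP => i j; rewrite -(homog_part_id (hM i j)) mxE.
have /rowP/(_ j) := wE i; rewrite !mxE => ->; rewrite homog_part_sum.
apply: eq_bigr => l _; rewrite (homog_partM _ _ (hD l j)) mxE; congr (homog_part _ _ * _).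
by ring.
Qed.

End Homogeneous.

(** * Graded lifting *)

Arguments shift {K N} F {i} a : rename.

Section Resolutions.
Variables (K : fieldType) (N : nat).
Notation R := {mpoly K[N]}.
Implicit Types (p q : R) (I J : R -> Prop) (F E : free_complex K N).

Record homogeneous_ideal I : Prop := HomogeneousIdeal {
  hideal0 : I 0;
  hidealD : forall p q, I p -> I q -> I (p + q);
  hidealM : forall c p, I p -> I (c * p);
  hideal_part : forall d p, I p -> I (homog_part d p)
}.

Section Ideal.
Variables (I : R -> Prop) (idI : homogeneous_ideal I).

Lemma hidealN p : I p -> I (- p).
Proof. by rewrite -mulN1r; apply: hidealM. Qed.

Lemma hidealB p q : I p -> I q -> I (p - q).
Proof. by move=> Ip /hidealN; apply: hidealD. Qed.

Lemma hideal_congr p q : I (p - q) -> I p <-> I q.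
Proof.
move=> Ipq; split=> [Ip|Iq]; last by rewrite -(subrK q p); apply: hidealD.
by rewrite -(subKr p q); apply: hidealB.
Qed.

Lemma hideal_sum (T : Type) (r : seq T) (P : pred T) (f : T -> R) :
  (forall i, I (f i)) -> I (\sum_(i <- r | P i) f i).
Proof. by move=> If; elim/big_ind: _ => //; [apply: hideal0|apply: hidealD]. Qed.

Lemma hideal_mulmx a (v : 'rV[R]_a) (C : 'cV[R]_a) :
  (forall i, I (C i 0)) -> I ((v *m C) 0 0).
Proof. by move=> IC; rewrite mxE; apply: hideal_sum => i; apply: hidealM. Qed.

End Ideal.

Lemma diff_solve I F : resolves_quotient I F ->
  forall i a (M : 'M_(a, rk F i.+1)), M *m diff F i = 0 ->
    forall v, exists w, row v M = w *m diff F i.+1.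
Proof.
by move=> [_ _ ex] i a M M0 v; apply/ex; rewrite -row_mul M0 row0.
Qed.

Lemma diff_diff I F : resolves_quotient I F ->
  forall i, diff F i.+1 *m diff F i = 0.
Proof.
move=> [_ _ ex] i; apply/row_matrixP => v; rewrite row0 row_mul.
by apply/ex; exists (row v 1%:M); rewrite -row_mul mul1mx.
Qed.

Lemma aug_diff I F : resolves_quotient I F ->
  forall i, I ((diff F 0 *m aug F) i 0).
Proof.
move=> [_ ex _] i.
rewrite -[X in I X](_ : (row i (diff F 0) *m aug F) 0 0 = _);
  last by rewrite -row_mul mxE.
by apply/ex; exists (row i 1%:M); rewrite -row_mul mul1mx.
Qed.

Lemma matrix_solve a b c (M : 'M[R]_(a, b)) (D : 'M[R]_(c, b)) :
  (forall v, exists w : 'rV_c, row v M = w *m D) -> exists W, M = W *m D.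
Proof.
move=> sol; have [w wE] : exists w : 'I_a -> 'rV_c, forall v, row v M = w v *m D.
  exact: (fin_all_exists (U := fun=> 'rV_c)) sol.
exists (\matrix_v w v).
by apply/row_matrixP => v; rewrite row_mul rowK wE.
Qed.

(** A chain map [E] -> [F] over multiplication by [g] on the quotients. The bottom square commutes
    only modulo [J], since augmentations are given by representatives. *)
Definition mul_lift (J : R -> Prop) (g : R) (E F : free_complex K N)
    (phi : forall i, 'M[R]_(rk E i, rk F i)) : Prop :=
  (forall a, J (g * aug E a 0 - (phi 0 *m aug F) a 0)) /\
  (forall i, phi i.+1 *m diff F i = diff E i *m phi i).

(** The comparison theorem: multiplication by [g] is well defined from R/J' to R/J, exactness of [F]
    lifts it degree by degree, and each lift is cut down to homogeneous entries. *)
Lemma mul_lift_exists J' J E F (e : int) (g : R) :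
  homogeneous_ideal J -> homogz e g -> (forall p, J' p -> J (g * p)) ->
  graded_complex E -> resolves_quotient J' E ->
  graded_complex F -> resolves_quotient J F ->
  exists phi : forall i, 'M[R]_(rk E i, rk F i), mul_lift J g phi /\
    forall i a b, homogz (shift E a + e - shift F b) (phi i a b).
Proof.
move=> idJ hg gJ [gE gE0] rE [gF gF0] rF.
(* Besides homogeneity, the invariant records that the composite with [diff E i] lands in the image
   of [diff F i], which is what the next lift needs. *)
pose Q i (phi : 'M[R]_(rk E i, rk F i)) :=
  (forall a b, homogz (shift E a + e - shift F b) (phi a b)) /\
  forall v, exists w, row v (diff E i *m phi) = w *m diff F i.
pose Q0 (phi : 'M[R]_(rk E 0, rk F 0)) :=
  (forall a, J (g * aug E a 0 - (phi *m aug F) a 0)).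
pose P i (phi : 'M[R]_(rk E i, rk F i)) (psi : 'M[R]_(rk E i.+1, rk F i.+1)) :=
  psi *m diff F i = diff E i *m phi.
have step i (phi : 'M[R]_(rk E i, rk F i)) : Q i phi ->
    exists psi, P i phi psi /\ Q i.+1 psi.
  move=> [hphi sol].
  have [|psi [psiE hpsi]] := homogeneous_solution (s := fun a => shift E a + e)
      (t := fun a => shift F a) (u := fun a => shift F a) _ (gF i) sol.
    move=> a b; rewrite mxE.
    apply: (big_ind (homogz _)) => [|p q|c _]; first exact: homogz0.
      exact: homogzD.
    rewrite (_ : _ - _ = (shift E a - shift E c) + (shift E c + e - shift F b)).
      exact: homogzM.
    by ring.
  exists psi; split=> //; split=> //; apply: (diff_solve rF).
  by rewrite -mulmxA -psiE mulmxA (diff_diff rE) mul0mx.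
have [phi0 [Q0phi hphi0]] : exists phi0, Q0 phi0 /\
    forall a b, homogz (shift E a + e - shift F b) (phi0 a b).
  have [sur _ _] := rF.
  have [v vE] : exists v : 'I_(rk E 0) -> 'rV_(rk F 0),
      forall a, J (g * aug E a 0 - (v a *m aug F) 0 0).
    exact: (fin_all_exists (U := fun=> 'rV_(rk F 0))) (fun a => sur _).
  (* The lift [v] is arbitrary; taking components of the right degrees keeps the congruence, because
     [J] is homogeneous. *)
  exists (\matrix_(a, b) homog_part (shift E a + e - shift F b) (v a 0 b)).
  split=> [a|a b]; last by rewrite mxE; apply: homog_part_homogz.
  have := hideal_part idJ (shift E a + e) (vE a).
  rewrite homog_partD homog_partN homog_part_id; last first.
    by rewrite [_ + e]addrC; apply: homogzM hg (gE0 a).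
  suff -> : homog_part (shift E a + e) ((v a *m aug F) 0 0) =
    \sum_j homog_part (shift E a + e - shift F j) (v a 0 j) * aug F j 0.
    by rewrite mxE; under [X in _ -> J (_ - X)]eq_bigr do rewrite mxE.
  rewrite mxE homog_part_sum; apply: eq_bigr => j _.
  by rewrite (homog_partM _ _ (gF0 j)).
have Qphi0 : Q 0 phi0.
  split=> // i; have [_ ex _] := rF; apply/ex.
  rewrite -row_mul -mulmxA mxE.
  (* Modulo [J] the value is [g] times an augmented boundary of [E]; the latter lies in [J'], so
     [gJ] applies. *)
  apply/(hideal_congr idJ (q := g * (diff E 0 *m aug E) i 0)).
    rewrite -opprB; apply: hidealN => //.
    rewrite !mxE mulr_sumr -sumrB; apply: hideal_sum => // j.
    rewrite mulrCA -mulrBr; apply: hidealM => //; exact: Q0phi.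
  by apply: gJ; apply: aug_diff rE _.
have [phi [phi0E Qphi Pphi]] := dependent_choice_nat Qphi0 step.
exists phi; split=> [|i a b]; last by have [] := Qphi i.
by split=> // a; rewrite phi0E; apply: Q0phi.
Qed.

End Resolutions.

(** * Uniqueness of the shifts *)

Section Comparison.
Variables (K : fieldType) (N : nat).
Notation R := {mpoly K[N]}.
Implicit Types (p q : R) (I J : R -> Prop) (F E : free_complex K N).

Notation const_part := (map_mx (mcoeff (0%MM : 'X_{1..N}) : R -> K)).

Lemma minimal_const_part F : minimal_complex F -> forall i, const_part (diff F i) = 0.
Proof. by move=> mF i; apply/matrixP => a b; rewrite !mxE mF. Qed.

(** Such a [theta] lifts the zero map of R/J, hence is null-homotopic. Both terms of the homotopy
    formula contain a differential, whose constant part vanishes by minimality. *)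
Lemma minimal_self_map_const J E (theta : forall i, 'M[R]_(rk E i)) :
  homogeneous_ideal J -> resolves_quotient J E -> minimal_complex E ->
  (forall a, J ((theta 0 *m aug E) a 0)) ->
  (forall i, theta i.+1 *m diff E i = diff E i *m theta i) ->
  forall i, const_part (theta i) = 0.
Proof.
move=> idJ rE mE th0 thS i.
(* The first equation is what constructs the next homotopy. The second holds because the difference
   is 0 in degree 0 and has a differential as left factor above it. *)
suff [h [_ hc]] : exists h : 'M_(rk E i, rk E i.+1),
    diff E i *m theta i = diff E i *m h *m diff E i /\
    const_part (theta i - h *m diff E i) = 0.
  move: hc; rewrite map_mxB map_mxM (minimal_const_part mE) mulmx0 subr0.
  exact.
elim: i => [|i [h [hE _]]].
  have [|h ->] := @matrix_solve _ _ _ _ _ (theta 0) (diff E 0).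
    move=> v; have [_ ex _] := rE; apply/ex.
    by rewrite -row_mul mxE; apply: th0.
  by exists h; rewrite mulmxA subrr map_mx0.
have [|h' h'E] := @matrix_solve _ _ _ _ _ (theta i.+1 - diff E i *m h) (diff E i.+1).
  by apply: (diff_solve rE); rewrite mulmxBl thS hE subrr.
exists h'; split; last first.
  have -> : theta i.+1 - h' *m diff E i.+1 = diff E i *m h by rewrite -h'E subKr.
  by rewrite map_mxM (minimal_const_part mE) mul0mx.
by rewrite -mulmxA -h'E mulmxBr mulmxA (diff_diff rE) mul0mx subr0.
Qed.

(** Lifting the identity both ways, [phi i *m psi i] has the identity as constant part. Hence row
    [a] of [phi i] has an entry with non-zero constant term; being homogeneous, that entry has
    degree 0, so the two shifts agree. Multiplicities do not matter for regularity. *)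
Lemma minimal_shift_unique J E F :
  homogeneous_ideal J ->
  minimal_graded_free_resolution J E -> minimal_graded_free_resolution J F ->
  forall i (a : 'I_(rk E i)), exists b : 'I_(rk F i), shift F b = shift E a.
Proof.
move=> idJ [gE rE mE] [gF rF _] i a.
have J1 p : J p -> J (1 * p) by rewrite mul1r.
have [phi [[phi0 phiS] hphi]] :=
  mul_lift_exists idJ (@homogz1 K N) J1 gE rE gF rF.
have [psi [[psi0 psiS] _]] :=
  mul_lift_exists idJ (@homogz1 K N) J1 gF rF gE rE.
have thc : const_part (phi i *m psi i - 1%:M) = 0.
  apply: (minimal_self_map_const (theta := fun i => phi i *m psi i - 1%:M) idJ rE mE).
    move=> c; rewrite mulmxBl mul1mx -mulmxA.
    have -> : (phi 0%N *m (psi 0%N *m aug E) - aug E) c 0 =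
      - (1 * aug E c 0 - (phi 0%N *m aug F) c 0)
      - (phi 0%N *m (aug F - psi 0%N *m aug E)) c 0.
      by rewrite mulmxBr !mxE; ring.
    apply: hidealB => //; first exact: hidealN.
    rewrite -[X in J X](_ : (row c (phi 0%N) *m (aug F - psi 0%N *m aug E)) 0 0 = _);
      last by rewrite -row_mul mxE.
    by apply: hideal_mulmx => // b; have := psi0 b; rewrite !mxE mul1r.
  move=> j; rewrite mulmxBl mulmxBr mul1mx mulmx1 -mulmxA psiS !mulmxA.
  by rewrite phiS.
move: thc; rewrite map_mxB map_mxM map_mx1 => /subr0_eq /matrixP /(_ a a).
rewrite !mxE eqxx mulr1n => sum1.
case: (pickP (fun b => (phi i a b)@_0%MM != 0)) => [b nz|z].
  exists b; have := homogz_const (hphi i a b) nz; rewrite addr0 => /subr0_eq.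
  by move=> ->.
have := oner_neq0 K; rewrite -sum1 big1 ?eqxx // => b _.
by rewrite !mxE /= (eqP (negbFE (z b))) mul0r.
Qed.

(** A single minimal resolution is enough to exhibit, which suits constructions; uniqueness of the
    shifts transfers the bound to all of them. *)
Definition has_regularity J (r : int) : Prop :=
  exists F, [/\ minimal_graded_free_resolution J F,
    forall i (a : 'I_(rk F i)), shift F a - i%:Z <= r
    & exists i (a : 'I_(rk F i)), shift F a - i%:Z = r].

Lemma has_regularity_quotient J r :
  homogeneous_ideal J -> has_regularity J r -> regularity_quotient J r.
Proof.
move=> idJ [F [resF le_r [i [a ra]]]]; split.
  exists i, (shift F a), #|[set b : 'I_(rk F i) | shift F b == shift F a]|.
  split=> //; first by exists F.
  by apply/eqP => /eqP; rewrite cards_eq0 => /eqP/setP/(_ a); rewrite !inE eqxx.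
move=> {i a ra} i j b [E [resE ->]]; rewrite cards_eq0 => /set0Pn[a].
rewrite inE => /eqP <-.
by have [c <-] := minimal_shift_unique idJ resE resF a.
Qed.

Lemma resolution_ext I J F : (forall p, I p <-> J p) ->
  minimal_graded_free_resolution I F -> minimal_graded_free_resolution J F.
Proof.
move=> IJ [gF [sur ex exS] mF]; split=> //; split=> // [p|v].
  by have [v /IJ] := sur p; exists v.
by rewrite -IJ.
Qed.

Lemma has_regularity_ext I J r : (forall p, I p <-> J p) ->
  has_regularity I r -> has_regularity J r.
Proof.
by move=> IJ [F [resF le_r ra]]; exists F; split=> //; apply: resolution_ext resF.
Qed.

Definition ring_resolution : free_complex K N :=
  FreeComplex (rk := fun i => if i is 0 then 1%N else 0%N)
    (fun _ _ => 0) (fun _ => 0) (const_mx 1).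

(** The base case of the induction on forests: no edges remain. *)
Lemma has_regularity0 : has_regularity (fun p : R => p = 0) 0.
Proof.
exists ring_resolution; split=> [|[|i] [] //|]; last by exists 0%N, ord0.
split=> [||i a b]; last by rewrite mxE mcoeff0.
  split=> [i a b|a] /=; first by rewrite mxE; apply: homogz0.
  by rewrite mxE; apply: homogz1.
have vE (v : 'rV[R]_1) : (v *m aug ring_resolution) 0 0 = v 0 0.
  by rewrite mxE big_ord1 mxE mulr1.
split=> [p|v|i v].
- by exists (const_mx p); rewrite vE mxE subrr.
- rewrite vE; split=> [v0|[w ->]]; last by rewrite thinmx0 mul0mx mxE.
  by exists 0; rewrite mul0mx; apply/rowP => j; rewrite ord1 v0 mxE.
- by split=> [_|_]; [exists 0; rewrite mul0mx; apply: thinmx0 | rewrite [v]thinmx0 mul0mx].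
Qed.

End Comparison.

(** * Mapping cones *)

Lemma split_lshift m n (i : 'I_m) : split (lshift n i) = inl i.
Proof. exact: (unsplitK (inl i)). Qed.

Lemma split_rshift m n (i : 'I_n) : split (rshift m i) = inr i.
Proof. exact: (unsplitK (inr i)). Qed.

Section MappingCone.
Variables (K : fieldType) (N : nat).
Notation R := {mpoly K[N]}.
Implicit Types (p q : R).
Variables (F F' : free_complex K N) (s : int).
Variable phi : forall i, 'M[R]_(rk F' i, rk F i).

(** In degree [j.+1] the cone is the sum of the term of [F] in degree [j.+1] and the term of [F'] in
    degree [j], twisted by [s], the degree of the multiplier. *)
Definition cone_rk i := if i is j.+1 then (rk F j.+1 + rk F' j)%N else rk F 0.

Definition cone_shift i : 'I_(cone_rk i) -> int :=
  match i with
  | 0 => fun a => shift F a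
  | j.+1 => fun a => match split a with
                     | inl b => shift F b
                     | inr b => shift F' b + s
                     end
  end.

(** The sign of the last block makes consecutive differentials compose to zero. *)
Definition cone_diff i : 'M[R]_(cone_rk i.+1, cone_rk i) :=
  match i with
  | 0 => col_mx (diff F 0) (phi 0)
  | j.+1 => block_mx (diff F j.+1) 0 (phi j.+1) (- diff F' j)
  end.

Definition mapping_cone : free_complex K N :=
  FreeComplex cone_shift cone_diff (aug F).

Lemma shift_coneL i (b : 'I_(rk F i.+1)) :
  @shift _ _ mapping_cone i.+1 (lshift _ b) = shift F b.
Proof. by rewrite [LHS]/(cone_shift _) /cone_shift split_lshift. Qed.

Lemma shift_coneR i (b : 'I_(rk F' i)) :
  @shift _ _ mapping_cone i.+1 (rshift _ b) = shift F' b + s.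
Proof. by rewrite [LHS]/(cone_shift _) /cone_shift split_rshift. Qed.

Lemma cone_graded : graded_complex F -> graded_complex F' ->
  (forall i a b, homogz (shift F' a + s - shift F b) (phi i a b)) ->
  graded_complex mapping_cone.
Proof.
move=> [gF gF0] [gF' _] hphi; split=> [i a b|a]; last exact: gF0.
change (homogz (shift mapping_cone a - shift mapping_cone b) (cone_diff i a b)).
case: i a b => [|i] a b; rewrite /cone_diff; case: (split_ordP a) => {}a ->;
  rewrite ?shift_coneL ?shift_coneR.
- by rewrite col_mxEu; apply: gF.
- by rewrite col_mxEd; apply: hphi.
- case: (split_ordP b) => {}b ->; rewrite ?shift_coneL ?shift_coneR.
    by rewrite block_mxEul; apply: gF.
  by rewrite block_mxEur mxE; apply: homogz0.
- case: (split_ordP b) => {}b ->; rewrite ?shift_coneL ?shift_coneR.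
    by rewrite block_mxEdl; apply: hphi.
  rewrite block_mxEdr mxE (_ : _ - _ = shift F' a - shift F' b); last by ring.
  exact/homogzN/gF'.
Qed.

Lemma cone_minimal : minimal_complex F -> minimal_complex F' ->
  (forall i a b, (phi i a b)@_0%MM = 0) -> minimal_complex mapping_cone.
Proof.
move=> mF mF' mphi [|i] a b /=; case: (split_ordP a) => {}a ->.
- by rewrite col_mxEu mF.
- by rewrite col_mxEd mphi.
- case: (split_ordP b) => {}b ->; first by rewrite block_mxEul mF.
  by rewrite block_mxEur mxE mcoeff0.
- case: (split_ordP b) => {}b ->; first by rewrite block_mxEdl mphi.
  by rewrite block_mxEdr mxE mcoeffN mF' oppr0.
Qed.

Variables (J J' : R -> Prop) (f : R).
Hypotheses (idJ : homogeneous_ideal J) (colon : forall p, J' p <-> J (f * p)).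
Hypotheses (rF : resolves_quotient J F) (rF' : resolves_quotient J' F').
Hypothesis lift_phi : mul_lift J f phi.

Let J_phi0 (w : 'rV[R]_(rk F' 0)) : J (f * (w *m aug F') 0 0 - (w *m phi 0 *m aug F) 0 0).
Proof.
have [phi0 _] := lift_phi.
rewrite -mulmxA mxE mulr_sumr [X in _ - X]mxE -sumrB.
apply: hideal_sum => // i; rewrite mulrCA -mulrBr.
exact: hidealM.
Qed.

(** An explicit form of the exact sequence 0 -> R/(J : f) -> R/J -> R/(J + (f)) -> 0, the first map
    being multiplication by [f]. *)
Lemma cone_resolves :
  resolves_quotient (fun p => exists c, J (p - c * f)) mapping_cone.
Proof.
have [surF exF exFS] := rF; have [surF' exF' exFS'] := rF'.
have [_ phiS] := lift_phi.
split=> [p|v|i v].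
- by have [v Jv] := surF p; exists v, 0; rewrite mul0r subr0.
- split=> [[c Jc]|[w ->]].
    have [w J'w] := surF' c.
    (* With [w] representing [c] in R/J', subtracting [w *m phi 0] from [v] cancels the multiple of
       [f]. The three summands below lie in [J] by assumption, by the colon property and by the
       lifting property. *)
    have /exF[u uE] : J (((v - w *m phi 0%N) *m aug F) 0 0).
      rewrite (_ : _ 0 0 = ((v *m aug F) 0 0 - c * f)
          + f * (c - (w *m aug F') 0 0)
          + (f * (w *m aug F') 0 0 - (w *m phi 0%N *m aug F) 0 0)).
        apply: (hidealD idJ); last exact: J_phi0.
        by apply: (hidealD idJ) => //; apply/colon.
      by rewrite mulmxBl [LHS]mxE [X in _ + X]mxE; ring.
    by exists (row_mx u w); rewrite mul_row_col -uE subrK.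
  rewrite -[w]hsubmxK; set u := lsubmx w; set w' := rsubmx w.
  rewrite mul_row_col mulmxDl [X in exists c, J (X - _)]mxE.
  exists ((w' *m aug F') 0 0).
  rewrite -addrA; apply: (hidealD idJ); first by apply/exF; exists u.
  by rewrite mulrC -opprB; apply: hidealN.
(* Once the [F'] part of a cycle is a boundary, correcting the [F] part by [w1 *m phi i.+1] gives a
   cycle of [F], hence a boundary. Both cases below use this. *)
have key (u : 'rV_(rk F i.+1)) (w : 'rV_(rk F' i)) w1 :
    w = w1 *m diff F' i -> u *m diff F i + w *m phi i = 0 ->
    exists u1, u = u1 *m diff F i.+1 - w1 *m phi i.+1.
  move=> wE uw0.
  have /exFS[u1 u1E] : (u + w1 *m phi i.+1) *m diff F i = 0.
    by rewrite mulmxDl -mulmxA phiS mulmxA -wE.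
  by exists u1; rewrite -u1E addrK.
case: i key v => [|i] key v; rewrite -[v]hsubmxK; set u := lsubmx v; set w := rsubmx v.
- split=> [|[z]].
    rewrite mul_row_col => uw0.
    (* In the lowest degree the cycle condition makes [w *m phi 0] a boundary, so [f] times the
       augmentation of [w] is in [J]; the colon property then gives membership in [J']. *)
    have /exF'[w1 w1E] : J' ((w *m aug F') 0 0).
      apply/colon/(hideal_congr idJ (J_phi0 w)).
      have -> : w *m phi 0%N = (- u) *m diff F 0.
        by apply/eqP; rewrite mulNmx -addr_eq0 addrC uw0.
      by apply/exF; exists (- u).
    have [u1 u1E] := key _ _ _ w1E uw0.
    exists (row_mx u1 (- w1)).
    by rewrite mul_row_block mulmx0 add0r u1E !mulNmx mulmxN opprK -w1E.
  rewrite -[z]hsubmxK mul_row_block => /eq_row_mx[-> ->].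
  rewrite mulmx0 add0r mul_row_col mulmxDl -!mulmxA (diff_diff rF) mulmx0 add0r.
  by rewrite mulNmx phiS mulmxN subrr.
- split=> [|[z]].
    rewrite mul_row_block mulmx0 add0r -[0]row_mx0 => /eq_row_mx[uw0].
    rewrite mulmxN => /eqP; rewrite oppr_eq0 => /eqP /exFS'[w1 w1E].
    have [u1 u1E] := key _ _ _ w1E uw0.
    exists (row_mx u1 (- w1)).
    by rewrite mul_row_block mulmx0 add0r u1E !mulNmx mulmxN opprK -w1E.
  rewrite -[z]hsubmxK mul_row_block => /eq_row_mx[-> ->].
  rewrite mulmx0 add0r mul_row_block mulmx0 add0r mulmxDl -!mulmxA (diff_diff rF).
  rewrite mulmx0 add0r mulNmx phiS mulmxN subrr.
  by rewrite mulmxN mulNmx opprK (diff_diff rF') mulmx0 row_mx0.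
Qed.

End MappingCone.

(* Lifting [g] first and multiplying the lift by [x] puts every entry of the
   comparison map in the maximal ideal, so that the cone is minimal. *)
Lemma has_regularity_cone (K : fieldType) (N : nat) (J J' : {mpoly K[N]} -> Prop)
    (x g : {mpoly K[N]}) (e r r' : int) :
  homogeneous_ideal J -> homogz 1 x -> homogz e g ->
  (forall p, J' p <-> J (x * g * p)) -> (forall p, J' p -> J (g * p)) ->
  has_regularity J r -> has_regularity J' r' ->
  has_regularity (fun p => exists c, J (p - c * (x * g))) (Num.max r (r' + e)).
Proof.
move=> idJ hx hg colon gJ [F [[gF rF mF] le_r [i1 [a1 E1]]]].
move=> [F' [[gF' rF' mF'] le_r' [i2 [a2 E2]]]].
have [psi [[psi0 psiS] hpsi]] := mul_lift_exists idJ hg gJ gF' rF' gF rF.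
pose phi i := x *: psi i.
have xlift : mul_lift J (x * g) phi.
  split=> [a|i]; last by rewrite -scalemxAl psiS -scalemxAr.
  by rewrite -scalemxAl mxE -mulrA -mulrBr; apply: hidealM.
exists (mapping_cone (e + 1) phi); split.
- split; [apply: cone_graded => // i a b|exact: cone_resolves|
    apply: cone_minimal => // i a b].
    rewrite mxE (_ : _ - _ = 1 + (shift F' a + e - shift F b)); last by ring.
    exact: homogzM.
  rewrite mxE (rmorphM (mcoeff 0%MM)) /=.
  suff -> : x@_0%MM = 0 by rewrite mul0r.
  by apply/eqP/negPn/negP => /(homogz_const hx).
- case=> [|i] a; first by rewrite le_max (le_r 0%N a).
  rewrite le_max; case: (split_ordP a) => b ->; rewrite ?shift_coneL ?shift_coneR.
    by rewrite (le_r i.+1 b).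
  (* The shift grows by [e + 1] and the homological degree by 1, a net gain of [e]. *)
  by have := le_r' i b; lia.
- have [_|_] := leP r (r' + e).
    by exists i2.+1, (rshift _ a2); rewrite shift_coneR; move: E2; lia.
  case: i1 a1 E1 => [|i] a1 E1; first by exists 0%N, a1.
  by exists i.+1, (lshift _ a1); rewrite shift_coneL.
Qed.

(** * Edge ideals as monomial ideals *)

Section MonomialIdeals.
Variables (K : fieldType) (N : nat).
Notation R := {mpoly K[N]}.
Implicit Types (p q : R) (m w : 'X_{1..N}) (P : 'X_{1..N} -> Prop).

(** Describing the ideal by a predicate on exponents turns colons by a monomial and sums with one
    into operations on predicates. *)
Definition monomial_ideal P p : Prop := forall m, m \in msupp p -> P m.

Definition up_closed P : Prop := forall m w, P m -> P (m + w)%MM.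

Lemma monomial_ideal_homogeneous P :
  up_closed P -> homogeneous_ideal (monomial_ideal P).
Proof.
move=> upP; split=> [m|p q Pp Pq m|c p Pp m|d p Pp m].
- by rewrite msupp0.
- by move=> /msuppD_le; rewrite mem_cat => /orP[/Pp|/Pq].
- by move=> /msuppM_le /allpairsP[[m1 m2] /= [_ /Pp h ->]]; rewrite addmC; apply: upP.
- by move=> /msupp_homog_part /Pp.
Qed.

Lemma monomial_ideal_colon P w p :
  monomial_ideal P ('X_[w] * p) <-> monomial_ideal (fun m => P (w + m)%MM) p.
Proof.
rewrite mulrC; split=> h m.
  by move=> pm; apply: h; rewrite (perm_mem (msuppMX p w)) map_f.
by rewrite (perm_mem (msuppMX p w)) => /mapP[m' /h h' ->].
Qed.

(** The terms of [p] divisible by ['X_[w]] are divided by it and collected in [c]; the others must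
    satisfy [P]. Conversely, a multiple of ['X_[w]] has only monomials divisible by it. *)
Lemma monomial_ideal_add P w (p : R) :
  monomial_ideal (fun m => P m \/ (w <= m)%MM) p <->
  exists c, monomial_ideal P (p - c * 'X_[w]).
Proof.
split=> [hp|[c hc] m pm].
  exists (\sum_(m <- msupp p | (w <= m)%MM) p@_m *: 'X_[m - w]).
  suff -> : p - (\sum_(m <- msupp p | (w <= m)%MM) p@_m *: 'X_[m - w]) * 'X_[w]
      = \sum_(m <- msupp p | ~~ (w <= m)%MM) p@_m *: 'X_[m].
    move=> m /msupp_sum_le /flattenP[t /mapP[m']]; rewrite mem_filter => /andP[wm pm ->].
    move=> /msuppZ_le; rewrite msuppX inE => /eqP ->.
    by case: (hp _ pm) => // h; rewrite h in wm.
  rewrite {1}(mpolyE p) (bigID (fun m => (w <= m)%MM)) /= mulr_suml.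
  apply/eqP; rewrite subr_eq addrC; apply/eqP; congr (_ + _).
  by apply: eq_bigr => m wm; rewrite -scalerAl -mpolyXD submK.
have [wm|wm] := boolP (w <= m)%MM; [by right|left].
apply: hc; rewrite mcoeff_msupp mcoeffB.
suff -> : (c * 'X_[w])@_m = 0 by rewrite subr0 -mcoeff_msupp.
apply/eqP/negPn; rewrite -mcoeff_msupp (perm_mem (msuppMX c w)).
by apply: contra wm => /mapP[m' _ ->]; apply: lem_addr.
Qed.

Lemma monomial_ideal_ext P Q : (forall m, P m <-> Q m) ->
  forall p, monomial_ideal P p <-> monomial_ideal Q p.
Proof. by move=> PQ p; split=> h m /h /PQ. Qed.

(** The cone for [x = 'X_i] and [g = 'X_[w]]: [Q] is the colon by their product, yet [g] alone
    already carries [Q] into [P]. *)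
Lemma has_regularity_monomial (P Q : 'X_{1..N} -> Prop) (i : 'I_N) (w : 'X_{1..N})
    (r s : int) :
  up_closed P ->
  (forall m, Q m <-> P (U_(i) + w + m)%MM) -> (forall m, Q m -> P (w + m)%MM) ->
  has_regularity (monomial_ideal P) r -> has_regularity (monomial_ideal Q) s ->
  has_regularity (monomial_ideal (fun m => P m \/ (U_(i) + w <= m)%MM))
    (Num.max r (s + (mdeg w)%:Z)).
Proof.
move=> upP QP Qw regP regQ.
apply: has_regularity_ext (fun p => iff_sym (monomial_ideal_add P _ p)) _.
have hU : homogz 1 ('X_i : R) by move=> m /homogzX; rewrite mdeg1.
rewrite mpolyXD.
apply: has_regularity_cone (monomial_ideal_homogeneous upP) hU (@homogzX _ _ w) _ _ regP regQ.
  move=> p; rewrite -mpolyXD; split=> [Qp|/monomial_ideal_colon Pp m pm].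
    by apply/monomial_ideal_colon => m /Qp /QP.
  by apply/QP/Pp.
by move=> p Qp; apply/monomial_ideal_colon => m /Qp /Qw.
Qed.

(** A variable that is a nonzerodivisor modulo the ideal: with [w = 0] the colon is the ideal
    itself, and the maximum is of [r] with [r]. *)
Lemma has_regularity_variable P (i : 'I_N) (r : int) :
  up_closed P -> (forall m, P (U_(i) + m)%MM -> P m) ->
  has_regularity (monomial_ideal P) r ->
  has_regularity (monomial_ideal (fun m => P m \/ m i != 0%N)) r.
Proof.
move=> upP Pi regP.
have := @has_regularity_monomial P P i 0%MM r r upP.
rewrite mdeg0 addr0 Order.POrderTheory.maxxx addm0 => h.
apply: has_regularity_ext (monomial_ideal_ext _) (h _ _ regP regP).
- by move=> m; rewrite lep1mP.
- by move=> m; split=> [/(@upP _ U_(i)%MM)|/Pi] //; rewrite addmC.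
- by move=> m; rewrite add0m.
Qed.

End MonomialIdeals.

(** * Edge ideals of induced subgraphs and the leaf recursion *)

Section EdgeIdeals.
Variables (K : fieldType) (G : sgraph).
Notation V := (vertex G).
Notation N := #|V|.
Implicit Types (u v x y : V) (W : {set V}) (m : 'X_{1..N}).

(** Vertices outside [W] stay as free variables, so all induced subgraphs share one polynomial
    ring. *)
Definition edge_monomial W m : Prop :=
  exists u v, [/\ u \in W, v \in W, edge u v,
    m (enum_rank u) != 0%N & m (enum_rank v) != 0%N].

Lemma edge_ideal_monomial (p : {mpoly K[N]}) :
  edge_ideal K G p <-> monomial_ideal (edge_monomial setT) p.
Proof.
split=> [[s [sE ->]] m|hp].
  move=> /msupp_sum_le /flattenP[t /mapP[c]]; rewrite mem_filter /= => cs ->.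
  have [u [v [uv ->]]] := sE c cs.
  rewrite /vertex_var -mpolyXD (perm_mem (msuppMX _ _)) => /mapP[m' _ ->].
  exists u, v; rewrite !inE !mnmDE !mnm1E !eqxx; split=> //.
  by rewrite addnAC addnC.
suff : forall (s : seq 'X_{1..N}) (f : 'X_{1..N} -> K),
    (forall m, m \in s -> edge_monomial setT m) ->
    edge_ideal K G (\sum_(m <- s) f m *: 'X_[m]).
  by move=> h; rewrite (mpolyE p); apply: h.
move=> s f; elim: s => [|m s IH] h.
  by exists [::]; rewrite !big_nil.
have [|s' [s'E sum]] := IH; first by move=> m' sm'; apply: h; rewrite inE sm' orbT.
have [u [v [_ _ uv mu mv]]] := h m (mem_head _ _).
pose w := (U_(enum_rank u) + U_(enum_rank v))%MM.
(* The ends of an edge are distinct, so positive exponents at both give divisibility by their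
   product. *)
have wm : (w <= m)%MM.
  apply/mnm_lepP => i; rewrite mnmDE !mnm1E.
  case: eqP => [<-|_]; last by case: eqP => [<-|_] //; rewrite add0n lt0n.
  case: eqP => [/enum_rank_inj vu|_]; last by rewrite addn0 lt0n.
  by rewrite vu edge_irrefl in uv.
exists ((f m *: 'X_[m - w], vertex_var K u * vertex_var K v) :: s'); split.
  by move=> c; rewrite inE => /orP[/eqP ->|/s'E //]; exists u, v.
by rewrite !big_cons sum /= -scalerAl /vertex_var -!mpolyXD submK.
Qed.

Lemma edge_monomial_up W : up_closed (edge_monomial W).
Proof.
move=> m w [u [v [uW vW uv mu mv]]]; exists u, v; split=> //.
  by rewrite mnmDE addn_eq0 negb_and mu.
by rewrite mnmDE addn_eq0 negb_and mv.
Qed.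

Definition vertex_edge_monomial (T : seq V) W m : Prop :=
  edge_monomial W m \/ exists2 v, v \in T & m (enum_rank v) != 0%N.

(** The variables are adjoined one at a time; a new one lies outside [W] and the earlier list, hence
    is a nonzerodivisor. *)
Lemma has_regularity_vertices (T : seq V) W (r : int) :
  (forall v, v \in T -> v \notin W) ->
  has_regularity (monomial_ideal (K := K) (edge_monomial W)) r ->
  has_regularity (monomial_ideal (K := K) (vertex_edge_monomial T W)) r.
Proof.
move=> + reg; elim: T => [|x T IH] TW.
  apply: has_regularity_ext reg; apply: monomial_ideal_ext => m.
  by split=> [|[//|[]]] //; left.
have {}IH := IH (fun v vT => TW v (mem_behead (s := x :: T) vT)).
have [xT|xT] := boolP (x \in T).
  apply: has_regularity_ext IH; apply: monomial_ideal_ext => m.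
  split=> [] [|[v vT mv]]; try by left.
    by right; exists v => //; rewrite inE vT orbT.
  by move: vT mv; rewrite inE => /orP[/eqP ->|vT] mv; right; [exists x|exists v].
have xW := TW x (mem_head _ _).
apply: has_regularity_ext (has_regularity_variable (i := enum_rank x) _ _ IH).
- apply: monomial_ideal_ext => m; split.
    case=> [[|[v vT mv]]|mx]; first by left.
      by right; exists v => //; rewrite inE vT orbT.
    by right; exists x => //; apply: mem_head.
  case=> [|[v]]; first by left; left.
  by rewrite inE => /orP[/eqP->|vT] mv; [right|left; right; exists v].
- move=> m w [/edge_monomial_up|[v vT mv]]; first by left.
  by right; exists v => //; rewrite mnmDE addn_eq0 negb_and mv.
have rank_neq v : v != x -> forall m, (U_(enum_rank x) + m)%MM (enum_rank v) = m (enum_rank v).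
  by move=> vx m; rewrite mnmDE mnm1E (inj_eq enum_rank_inj) eq_sym (negbTE vx).
move=> m [[u [v [uW vW uv]]]|[v vT]].
  rewrite !rank_neq; [|by apply: contraNneq xW => <-..].
  by move=> mu mv; left; exists u, v.
rewrite rank_neq; last by apply: contraNneq xT => <-.
by move=> mv; right; exists v.
Qed.

Lemma has_regularity_leaf W x y (r s : int) :
  x \in W -> y \in W -> edge x y -> (forall u, u \in W -> edge x u -> u = y) ->
  has_regularity (monomial_ideal (K := K) (edge_monomial (W :\ x))) r ->
  has_regularity (monomial_ideal (K := K)
    (edge_monomial [set u in W | (u != y) && ~~ edge y u])) s ->
  has_regularity (monomial_ideal (K := K) (edge_monomial W)) (Num.max r (s + 1)).
Proof.
move=> xW yW xy leaf regr regs.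
set W2 := [set u in W | _] in regs.
pose T := enum [set u in W :\ x | edge y u].
have nyy := edge_irrefl y.
have xNy : x != y by apply: contraTneq xy => ->; rewrite edge_irrefl.
have yxE : edge y x by rewrite edge_sym.
have TW2 v : v \in T -> v \notin W2 by rewrite mem_enum !inE => /andP[_ ->]; rewrite !andbF.
have regT := has_regularity_vertices TW2 regs.
have rk u v m : (U_(enum_rank u) + m)%MM (enum_rank v) = ((u == v) + m (enum_rank v))%N.
  by rewrite mnmDE mnm1E (inj_eq enum_rank_inj).
(* Multiplication by [y] alone sends the colon ideal into I(W - x): a vertex of [T] forms an edge
   with [y]. This is what lets the comparison map be divisible by [x]. *)
have sub m : vertex_edge_monomial T W2 m ->
    edge_monomial (W :\ x) (U_(enum_rank y) + m)%MM.
  case=> [[u [v []]]|[v]].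
    rewrite !inE => /and3P[uW _ yu] /and3P[vW _ yv] uv mu mv; exists u, v.
    rewrite !inE uW vW !rk !addn_eq0 !negb_and mu mv !orbT; split=> //.
      by rewrite andbT; apply: contraNneq yu => ->.
    by rewrite andbT; apply: contraNneq yv => ->.
  rewrite mem_enum !inE => /andP[/andP[vx vW] yv] mv; exists y, v.
  by rewrite !inE vx vW yW eq_sym xNy !rk eqxx !addn_eq0 !negb_and mv orbT.
(* The edge found avoids [x]. If it meets [y], its other end is in [T]; otherwise one of its ends is
   in [T] or both are in [W2]. *)
have sup m : edge_monomial (W :\ x) (U_(enum_rank x) + U_(enum_rank y) + m)%MM ->
    vertex_edge_monomial T W2 m.
  case=> u [v []]; rewrite !inE -!addmA !rk => /andP[ux uW] /andP[vx vW] uv.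
  rewrite ![x == _]eq_sym (negbTE ux) (negbTE vx) !add0n.
  have [yu _|yu] := eqVneq y u.
    subst u; have yv : y != v by apply: contraTneq uv => <-; rewrite nyy.
    rewrite (negbTE yv) add0n => mv; right; exists v => //.
    by rewrite mem_enum !inE vx vW.
  have [yv mu _|yv] := eqVneq y v.
    subst v; right; exists u => //.
    by rewrite mem_enum !inE ux uW edge_sym.
  rewrite !add0n => mu mv.
  have [yu'|yu'] := boolP (edge y u).
    by right; exists u => //; rewrite mem_enum !inE ux uW.
  have [yv'|yv'] := boolP (edge y v).
    by right; exists v => //; rewrite mem_enum !inE vx vW.
  by left; exists u, v; rewrite !inE uW vW yu' yv' ![_ == y]eq_sym yu yv.
have := has_regularity_monomial (i := enum_rank x) (w := U_(enum_rank y)%MM)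
  (@edge_monomial_up (W :\ x)) _ sub regr regT.
rewrite mdeg1 => h; apply: has_regularity_ext (h _); last first.
  move=> m; split=> [/sub|/sup //].
  by rewrite -addmA [(U_(_) + (_ + _))%MM]addmC; apply: edge_monomial_up.
apply: monomial_ideal_ext => m; split=> [[|]|].
- case=> u [v []]; rewrite !inE => /andP[_ uW] /andP[_ vW] uv mu mv.
  by exists u, v.
- move=> /mnm_lepP le; exists x, y; split=> //.
    by have := le (enum_rank x); rewrite addmC rk mnm1E eqxx addn1 -lt0n; apply: leq_ltn_trans.
  by have := le (enum_rank y); rewrite rk mnm1E eqxx addn1 -lt0n; apply: leq_ltn_trans.
case=> u [v [uW vW uv mu mv]].
(* Inside [W] the only edge at [x] goes to [y], so an edge monomial using [x] is divisible by
   [xy]. *)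
have edge_x z : z \in W -> edge x z -> m (enum_rank x) != 0%N -> m (enum_rank z) != 0%N ->
    (U_(enum_rank x) + U_(enum_rank y) <= m)%MM.
  move=> zW xz mx; rewrite (leaf z zW xz) => my.
  apply/mnm_lepP => i; rewrite mnmDE !mnm1E.
  case: eqP => [<-|_]; last by case: eqP => [<-|_] //; rewrite add0n lt0n.
  by rewrite (inj_eq enum_rank_inj) eq_sym (negbTE xNy) addn0 lt0n.
have [ux|ux] := eqVneq u x; first by right; subst u; apply: (edge_x v).
have [vx|vx] := eqVneq v x.
  by right; subst v; apply: (edge_x u) => //; rewrite edge_sym.
by left; exists u, v; rewrite !inE ux vx.
Qed.

End EdgeIdeals.

(** * Forests *)

Section InducedMatchings.
Variables (K : fieldType) (G : sgraph).
Notation V := (vertex G).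
Implicit Types (u v x y : V) (W : {set V}) (M : {set V * V}).

Definition close u v := (u == v) || edge u v.

Definition touch (p q : V * V) :=
  [|| close p.1 q.1, close p.1 q.2, close p.2 q.1 | close p.2 q.2].

(** Edges are ordered pairs. The two orientations of an edge touch, so at most one of them occurs
    and the cardinal counts edges. *)
Definition induced_matching W M : Prop :=
  (forall p, p \in M -> [/\ p.1 \in W, p.2 \in W & edge p.1 p.2]) /\
  (forall p q, p \in M -> q \in M -> touch p q -> p = q).

Definition matching_number W (r : nat) : Prop :=
  (exists2 M, induced_matching W M & #|M| = r) /\
  (forall M, induced_matching W M -> (#|M| <= r)%N).

Lemma close_sym u v : close u v = close v u.
Proof. by rewrite /close eq_sym edge_sym. Qed.

Lemma touch_sym p q : touch p q = touch q p.
Proof.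
by rewrite /touch !(close_sym q.1) !(close_sym q.2); congr (_ || _); apply: orbCA.
Qed.

Lemma induced_matching_sub W W' M M' : W \subset W' -> M' \subset M ->
  induced_matching W M -> induced_matching W' M'.
Proof.
move=> /subsetP WW' /subsetP MM' [ed ind]; split=> [p /MM' /ed[]|p q /MM' pM /MM'].
  by move=> /WW' ? /WW'.
exact: ind.
Qed.

(** A matching away from N[y] can be enlarged by [xy]. Conversely, a matching using [x] contains the
    edge [xy], and its other edges avoid N[y]. *)
Lemma matching_number_leaf W x y (r s : nat) :
  x \in W -> y \in W -> edge x y -> (forall u, u \in W -> edge x u -> u = y) ->
  matching_number (W :\ x) r ->
  matching_number [set u in W | (u != y) && ~~ edge y u] s ->
  matching_number W (maxn r s.+1).
Proof.
set W2 := [set u in W | _] => xW yW xy leaf [[M1 ind1 card1] max1] [[M2 ind2 card2] max2].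
have yx : edge y x by rewrite edge_sym.
have subW2 : W2 \subset W by apply/subsetP => u; rewrite inE => /andP[].
split.
  case: (leqP r s.+1) => _; last first.
    by exists M1 => //; apply: induced_matching_sub ind1; rewrite ?subD1set.
  have far p : p \in M2 -> touch (x, y) p = false.
    case: ind2 => ed2 _ /ed2[]; rewrite !inE => /and3P[pW py yp] /and3P[qW qy yq] pq.
    rewrite /touch /close /= ![y == _]eq_sym (negbTE py) (negbTE qy) (negbTE yp) (negbTE yq).
    have notx u : u \in W -> u != y -> ~~ edge y u -> (x == u) || edge x u = false.
      move=> uW uy yu; apply/norP; split; first by apply: contraNneq yu => <-.
      by apply: contra uy => /leaf->.
    by rewrite !notx.
  have xyM2 : (x, y) \notin M2.
    by apply/negP => /far; rewrite /touch /close eqxx.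
  exists ((x, y) |: M2); last by rewrite cardsU1 xyM2 card2.
  split=> [p|p q]; rewrite !inE.
    case/predU1P => [-> //|pM]; case: ind2 => /(_ _ pM)[p1 p2 pe] _.
    by split=> //; apply: (subsetP subW2).
  case/predU1P => [->|pM] /predU1P[->|qM] //.
  - by rewrite far.
  - by rewrite touch_sym far.
  - by case: ind2 => _; apply.
move=> M indM; have [ed ind] := indM; rewrite leq_max.
case: (pickP [pred p in M | (p.1 == x) || (p.2 == x)]) => [p /= /andP[pM px]|noX].
  apply/orP; right.
  have [p1W p2W pe] := ed p pM.
  have pyx : p.1 = y \/ p.2 = y.
    case/orP: px => /eqP px; rewrite px in pe *.
      by right; apply: leaf pe.
    rewrite edge_sym in pe.
    by left; apply: leaf pe.
  rewrite (cardsD1 p) pM ltnS; apply: max2.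
  split=> [q|q q']; rewrite !inE; last by move=> /andP[_ ?] /andP[_ ?]; apply: ind.
  move=> /andP[qp qM]; have [q1W q2W qe] := ed q qM.
  have nt : touch p q = false by apply: contraNF qp => /(ind _ _ pM qM) ->.
  suff [-> ->] : ((q.1 != y) && ~~ edge y q.1) /\ ((q.2 != y) && ~~ edge y q.2).
    by rewrite q1W q2W.
  move: nt; rewrite /touch /close.
  by case: pyx => -> /norP[/norP[? ?] /norP[/norP[? ?] /norP[/norP[? ?] /norP[? ?]]]];
    rewrite ![_ == y]eq_sym; split; apply/andP.
apply/orP; left; apply: max1; split=> // p pM.
have [p1 p2 pe] := ed p pM; rewrite !inE p1 p2 !andbT.
by have := noX p; rewrite /= pM /= => /norP[].
Qed.

(** The condition on [depth] certifies acyclicity: no vertex has two neighbours at most as deep as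
    itself. A deepest non-isolated vertex is then a leaf, and both smaller vertex sets fall under
    induction on the cardinal. *)
Lemma forest_regularity (depth : V -> nat) W :
  (forall v u u', edge v u -> edge v u' ->
    (depth u <= depth v)%N -> (depth u' <= depth v)%N -> u = u') ->
  exists2 r : nat, matching_number W r &
    has_regularity (monomial_ideal (K := K) (edge_monomial W)) r%:Z.
Proof.
move=> forest; move: {2}#|W|.+1 (ltnSn #|W|) => c; elim: c W => // c IH W cW.
case: (pickP [pred x in W | [exists y in W, edge x y]]) => [x0 nonisol|isol]; last first.
  have noedge u v : u \in W -> v \in W -> edge u v -> False.
    move=> uW vW uv; have /negP := negbT (isol u); apply.
    by rewrite /= uW; apply/exists_inP; exists v.
  exists 0%N.
    split; first by exists set0; rewrite ?cards0 //; split=> p; rewrite ?inE.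
    move=> M [ed _]; rewrite leqn0 cards_eq0; apply/set0Pn => -[p /ed[]].
    exact: noedge.
  apply: has_regularity_ext (has_regularity0 K _) => p; split=> [-> m|hp].
    by rewrite msupp0.
  apply: msuppnil0; case s: (msupp p) => [|m t] //.
  have [|u [v [uW vW uv _ _]]] := hp m; first by rewrite s mem_head.
  by case: (noedge u v).
have [x /= /andP[xW /exists_inP[y yW xy]] xmax] := @arg_maxnP _ x0
  [pred x in W | [exists y in W, edge x y]] depth nonisol.
have dep u : u \in W -> edge x u -> (depth u <= depth x)%N.
  move=> uW xu; apply: xmax; rewrite /= uW; apply/exists_inP; exists x => //.
  by rewrite edge_sym.
have leaf u : u \in W -> edge x u -> u = y.
  by move=> uW xu; apply: (forest x) => //; apply: dep.
have [|r mr regr] := IH (W :\ x).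
  by move: cW; rewrite (cardsD1 x W) xW.
have [|s ms regs] := IH [set u in W | (u != y) && ~~ edge y u].
  rewrite ltnS in cW; apply: leq_trans cW; apply: proper_card; apply/properP; split.
    by apply/subsetP => u; rewrite inE => /andP[].
  by exists y => //; rewrite !inE eqxx andbF.
exists (maxn r s.+1); first exact: matching_number_leaf mr ms.
have := has_regularity_leaf xW yW xy leaf regr regs.
by congr has_regularity; lia.
Qed.

End InducedMatchings.

(** * The semiregular tree *)

Lemma regularity_quotient_ext (K : fieldType) (N : nat)
    (I J : {mpoly K[N]} -> Prop) (r : int) :
  (forall p, I p <-> J p) -> regularity_quotient I r -> regularity_quotient J r.
Proof.
have ext I' J' i j b : (forall p, I' p <-> J' p) ->
    @graded_betti_number K N I' i j b -> graded_betti_number J' i j b.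
  by move=> IJ [F [resF bE]]; exists F; split=> //; apply: resolution_ext resF.
move=> IJ [[i [j [b [Ib b0 jr]]]] maxI]; split.
  by exists i, j, b; split=> //; apply: ext Ib.
move=> {b0 jr Ib} i' j' b' Jb; apply: (maxI i' j'); apply: ext Jb => p.
exact: iff_sym.
Qed.

Lemma card_ord_lt_pred n : #|[set a : 'I_n | (a < n.-1)%N]| = n.-1.
Proof.
case: n => [|n]; first by apply: eq_card0 => -[].
transitivity #|[set~ (ord_max : 'I_n.+1)]|; last by rewrite cardsC1 card_ord.
by apply: eq_card => a; rewrite !inE -val_eqE /=; have := ltn_ord a; lia.
Qed.

(** Excluding two residues forces the third; neither [a.+1] nor [a.+2] equals [k], whence
    [a.+2 < k]. *)
Lemma modn3_cases a k : (a < k -> a.+1 %% 3 != k %% 3 -> a.+2 %% 3 != k %% 3 ->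
  a.+2 < k /\ a.+3 %% 3 == k %% 3)%N.
Proof. by lia. Qed.

Section Tree.
Local Open Scope nat_scope.
Variables (n k : nat).
Notation V := (tree_vertex n k).
Notation G := (semiregular_tree n k).
Implicit Types (u v w : V) (s : seq 'I_n).

Definition word v : seq 'I_n := val (val v).

Lemma word_inj : injective word.
Proof. by move=> u v /val_inj /val_inj. Qed.

Lemma size_word v : size (word v) <= k.
Proof. exact: size_bseq. Qed.

Lemma all_word v : all (fun a : 'I_n => a < n.-1) (behead (word v)).
Proof. exact: (valP v). Qed.

Lemma word_onto s : size s <= k -> all (fun a : 'I_n => a < n.-1) (behead s) ->
  exists v, word v = s.
Proof. by move=> sk sa; exists (exist _ (Bseq sk) sa). Qed.

Lemma is_childP u v : reflect (exists a, word v = rcons (word u) a) (is_child u v).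
Proof. by apply: (iffP existsP) => -[a e]; exists a; apply/eqP. Qed.

Lemma is_child_size u v : is_child u v -> size (word v) = (size (word u)).+1.
Proof. by move=> /is_childP[a ->]; rewrite size_rcons. Qed.

Lemma parent_unique u u' v : is_child u v -> is_child u' v -> u = u'.
Proof.
by move=> /is_childP[a e] /is_childP[b]; rewrite e => /rcons_inj[/word_inj].
Qed.

Lemma tree_depth_forest v u u' : tree_edge v u -> tree_edge v u' ->
  size (word u) <= size (word v) -> size (word u') <= size (word v) -> u = u'.
Proof.
move=> /orP[/is_child_size|c1]; first by lia.
move=> /orP[/is_child_size|c2]; first by lia.
by move=> _ _; apply: parent_unique c1 c2.
Qed.

(** The depths are k - 1, k - 4, and so on; the successor avoids truncated subtraction. *)
Definition centers : {set V} :=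
  [set v | (size (word v) < k) && ((size (word v)).+1 %% 3 == k %% 3)].

Hypothesis n_gt1 : 1 < n.

Lemma child_exists v : size (word v) < k -> exists w, is_child v w.
Proof.
move=> vk; have n0 : 0 < n by lia.
have [||w wE] := @word_onto (rcons (word v) (Ordinal n0)); first by rewrite size_rcons.
  have := all_word v; case: (word v) => //= a s; rewrite all_rcons => ->.
  by rewrite /= andbT; lia.
by exists w; apply/is_childP; exists (Ordinal n0).
Qed.

(** Each center is paired with a child. Depths of centers agree modulo 3, so two touching pairs
    start at the same depth, and then uniqueness of parents identifies their centers. *)
Lemma centers_induced_matching :
  exists2 M, @induced_matching G setT M & #|M| = #|centers|.
Proof.
(* Outside [centers] the implication is vacuous and [v] is a dummy value, which makes the choice a
   total function. *)
have child v : exists w, (v \in centers) ==> is_child v w.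
  have [|_] := boolP (v \in centers); last by exists v.
  by rewrite inE => /andP[/child_exists].
have [c cE] : exists c : V -> V, forall v, (v \in centers) ==> is_child v (c v).
  exact: (fin_all_exists (U := fun=> V)) child.
exists [set (v, c v) | v in centers]; last first.
  by rewrite card_imset // => u v [].
split=> [_ /imsetP[v vC ->]|_ _ /imsetP[u uC ->] /imsetP[v vC ->]] /=.
  by rewrite !inE; split=> //; apply/orP; left; apply: implyP vC.
have cu := implyP (cE u) uC; have cv := implyP (cE v) vC.
have su := is_child_size cu; have sv := is_child_size cv.
move: uC vC; rewrite !inE => /andP[_ ku] /andP[_ kv].
suff touchE : touch (G := G) (u, c u) (v, c v) -> u = v by move=> /touchE ->.
case/or4P; rewrite /close /= => /orP[/eqP e|/orP[] e];
  try (have := is_child_size e); try exact: e; try lia.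
- by move: e => /(congr1 (size \o word)) /=; lia.
- by move=> _; apply: parent_unique e cv.
- by move: e => /(congr1 (size \o word)) /=; lia.
- by move=> _; apply: parent_unique cu e.
- by apply: parent_unique cu _; rewrite e.
Qed.

(** Each edge is sent to a center that is one of its ends or a child of one. Edges with the same
    center have ends equal to that center or to its parent, so they touch and coincide. *)
Lemma induced_matching_centers (M : {set V * V}) :
  @induced_matching G setT M -> #|M| <= #|centers|.
Proof.
move=> [ed ind].
pose anchored (p : V * V) y := [exists w, ((w == p.1) || (w == p.2)) &&
  ((w == y) || is_child w y)].
have anchorP p : p \in M -> exists2 y, y \in centers & anchored p y.
  move=> pM; have [_ _ pe] := ed p pM.
  have [u [v [uv up vp]]] : exists u v, [/\ is_child u v,
      (u == p.1) || (u == p.2) & (v == p.1) || (v == p.2)].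
    by case/orP: pe => e; [exists p.1, p.2|exists p.2, p.1]; rewrite !eqxx ?orbT.
  have sv := is_child_size uv; have vk := size_word v.
  have [ku|ku] := eqVneq ((size (word u)).+1 %% 3) (k %% 3).
    exists u; first by rewrite inE ku eqxx andbT -sv.
    by apply/existsP; exists u; rewrite up eqxx.
  have [kv|kv] := eqVneq ((size (word v)).+1 %% 3) (k %% 3).
    exists v; last by apply/existsP; exists v; rewrite vp eqxx.
    rewrite inE kv eqxx andbT ltn_neqAle vk andbT.
    (* If [v] were a leaf, the depth of [u] would be k - 1, a case already excluded. *)
    by apply: contraNneq ku => vk'; rewrite -sv vk'.
  (* Neither end has the depth of a center, so any child of the lower end [v] does. *)
  rewrite sv in kv vk; have [wk w3] := modn3_cases vk ku kv.
  have [|w vw] := @child_exists v; first by rewrite sv ltnW.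
  exists w; first by rewrite inE (is_child_size vw) sv wk w3.
  by apply/existsP; exists v; rewrite vp vw orbT.
pose f p := odflt p.1 [pick y in centers | anchored p y].
have fP p : p \in M -> f p \in centers /\ anchored p (f p).
  move=> /anchorP[y yC ay]; rewrite /f; case: pickP => [z /andP[]//|/(_ y)].
  by rewrite /= yC ay.
rewrite -(card_in_imset (f := f) (D := mem M)); last first.
  move=> p q pM qM fpq; apply: ind => //.
  have [_ /existsP[w /andP[wp wy]]] := fP p pM.
  have [_ /existsP[w' /andP[wq wy']]] := fP q qM.
  have ww' : close (G := G) w w'.
    rewrite /close /= /tree_edge -fpq in wy' *.
    case/orP: wy => [/eqP wy|wy]; case/orP: wy' => [/eqP wy'|wy'].
    - by rewrite wy wy' eqxx.
    - by rewrite wy wy' !orbT.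
    - by rewrite wy' wy orbT.
    - by rewrite (parent_unique wy wy') eqxx.
  rewrite /touch.
  by case/orP: wp => /eqP <-; case/orP: wq => /eqP <-; rewrite ww' ?orbT.
by apply/subset_leq_card/subsetP => _ /imsetP[p pM ->]; case: (fP p pM).
Qed.

Lemma tree_matching_number r :
  @matching_number G setT r -> r = #|centers|.
Proof.
move=> [[M indM <-] max]; apply/eqP; rewrite eqn_leq induced_matching_centers //.
by have [M' indM' <-] := centers_induced_matching; apply: max.
Qed.

(** * Counting vertices by depth *)

Definition level d : {set V} := [set v | size (word v) == d].

Lemma card_level0 : #|level 0| = 1.
Proof.
have [//|//|v0 v0E] := @word_onto [::].
apply/eqP/cards1P; exists v0; apply/setP => v; rewrite !inE size_eq0.
by apply/eqP/eqP => [vE|->//]; apply: word_inj; rewrite vE.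
Qed.

(** Appending a letter is a bijection from pairs in [setX (level d) B] to the next level, where [B]
    holds the letters allowed after a word of length [d]. *)
Lemma card_levelS d : d < k ->
  #|level d.+1| = #|level d| * (if d == 0 then n else n.-1).
Proof.
move=> dk; pose B : {set 'I_n} := [set a : 'I_n | (d == 0) || (a < n.-1)].
have -> : (if d == 0 then n else n.-1) = #|B|.
  rewrite /B; case: (d) => [|d'] /=; last by rewrite card_ord_lt_pred.
  by rewrite -[LHS]card_ord -cardsT; apply: eq_card => a; rewrite !inE.
rewrite -cardsX.
have ext (p : V * 'I_n) : exists w,
    (p \in setX (level d) B) ==> (word w == rcons (word p.1) p.2).
  case: (boolP (p \in _)) => [|_]; last by exists p.1.
  case: p => v a; rewrite !inE /= => /andP[/eqP vd Ba].
  have [||w wE] := @word_onto (rcons (word v) a); last by exists w; rewrite wE eqxx.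
    by rewrite size_rcons vd.
  have := all_word v; case: (word v) vd => [|b s] //= sd; rewrite all_rcons => ->.
  by rewrite andbT; move: Ba; rewrite -sd.
have [g gE] : exists g : V * 'I_n -> V, forall p,
    (p \in setX (level d) B) ==> (word (g p) == rcons (word p.1) p.2).
  exact: (fin_all_exists (U := fun=> V)) ext.
rewrite -(card_in_imset (f := g)); last first.
  move=> [u a] [v b] /(implyP (gE _))/eqP gu /(implyP (gE _))/eqP gv guv.
  by move: gv; rewrite -guv gu => /rcons_inj[/word_inj -> ->].
apply: eq_card => w; rewrite inE; apply/eqP/imsetP => [wd|[[v a] vB ->]]; last first.
  rewrite (eqP (implyP (gE _) vB)) size_rcons.
  by move: vB; rewrite !inE /= => /andP[/eqP->].
move: wd; case/lastP wE: (word w) => [|s a] //; rewrite size_rcons => -[sd].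
have := all_word w; rewrite wE => wa.
have [||v vE] := @word_onto s; first by lia.
  by case: s wa {wE sd} => //= b s; rewrite all_rcons => /andP[].
have vaB : (v, a) \in setX (level d) B.
  rewrite !inE /= vE sd eqxx /=; case: s wa sd {wE vE} => [|b s] /=; first by move=> _ <-.
  by rewrite all_rcons => /andP[-> _] <-; rewrite orbT.
exists (v, a) => //; apply: word_inj.
by rewrite (eqP (implyP (gE _) vaB)) vE.
Qed.

Definition level_size d := if d is d'.+1 then n * n.-1 ^ d' else 1.

Lemma card_level d : d <= k -> #|level d| = level_size d.
Proof.
elim: d => [_|[|d] IH dk]; first exact: card_level0.
  by rewrite card_levelS // card_level0 mulnC.
by rewrite card_levelS // IH ?(ltnW dk) //= expnSr mulnA.
Qed.

Lemma card_centers :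
  #|centers| = \sum_(d < k | d.+1 %% 3 == k %% 3) level_size d.
Proof.
rewrite -sum1_card.
pose h v : 'I_k.+1 := inord (size (word v)).
have hE v : h v = size (word v) :> nat by rewrite inordK // ltnS size_word.
rewrite (partition_big h (fun d => (d < k) && (d.+1 %% 3 == k %% 3))) /=; last first.
  by move=> v; rewrite inE hE.
(* The fibres run over the depths 0 to k; depth k, that of the leaves, contributes nothing. *)
rewrite big_mkcond big_ord_recr /= ltnn addn0 [RHS]big_mkcond /=.
apply: eq_bigr => d _; rewrite ltn_ord /=; case: ifP => // dk.
rewrite -(card_level (ltnW (ltn_ord d))) -sum1_card; apply: eq_bigl => v.
rewrite !inE -val_eqE /= hE.
by have [->|_] := eqVneq (size (word v)) d; rewrite ?andbF // ltn_ord dk.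
Qed.

End Tree.

(** Raising [k] by 3 adds a single level, of size n q^(k+1), so within a residue class the sum is
    geometric with ratio q^3. *)
Lemma level_sum_formula (n k : nat) : (3 <= n)%N ->
  ((\sum_(d < k | d.+1 %% 3 == k %% 3) level_size n d)%N%:R : rat) =
    let q : rat := n%:R - 1 in
    if (k %% 3 == 0)%N then (n%:R * q ^+ k.+1 - n%:R * q) / (q ^+ 3 - 1)
    else if (k %% 3 == 1)%N then (n%:R * q ^+ k.+1 - q ^+ 2 - 1) / (q ^+ 3 - 1)
    else (n%:R * q ^+ k.+1 - n%:R) / (q ^+ 3 - 1).
Proof.
move=> n3; cbv zeta; set q : rat := n%:R - 1.
have qE : q = n.-1%:R by rewrite -subn1 natrB //; lia.
have nE : n%:R = q + 1 by rewrite /q subrK.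
have q2 : 2%:R <= q by rewrite qE ler_nat; lia.
have q3 : q ^+ 3 - 1 != 0.
  rewrite subr_eq0 gt_eqF // exprn_egt1 //.
  by apply: lt_le_trans q2; rewrite ltr1n.
have step c : (\sum_(d < c.+3 | d.+1 %% 3 == c.+3 %% 3) level_size n d =
    \sum_(d < c | d.+1 %% 3 == c %% 3) level_size n d + n * n.-1 ^ c.+1)%N.
  have c3 : (c.+3 %% 3 = c %% 3)%N by rewrite -addn3 modnDr.
  have c1 : (c.+1 %% 3 == c %% 3)%N = false by lia.
  have c2 : (c.+2 %% 3 == c %% 3)%N = false by lia.
  by rewrite c3 big_mkcond !big_ord_recr /= -big_mkcond c1 c2 c3 eqxx !addn0.
(* The constant subtracted in each numerator, fixed by the initial sums 0, 1 and n for k = 0, 1,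
   2. *)
pose corr b : rat := if b == 0%N then n%:R * q else if b == 1%N then q ^+ 2 + 1 else n%:R.
have sumE m b : (b < 3)%N -> let c := (m * 3 + b)%N in
    (\sum_(d < c | d.+1 %% 3 == c %% 3) level_size n d)%N%:R * (q ^+ 3 - 1)
    = n%:R * q ^+ c.+1 - corr b.
  move=> b3 /=; elim: m => [|m IH].
    rewrite mul0n add0n; case: b b3 => [|[|[|//]]] _ /=;
      rewrite big_mkcond ?big_ord_recr /= ?big_ord0 ?addn0 /corr /= ?muln1 ?nE; ring.
  rewrite mulSn -addnA !add3n; set c := (m * 3 + b)%N in IH *.
  by rewrite step natrD mulrDl IH natrM natrX -qE !exprS; ring.
have := sumE (k %/ 3)%N (k %% 3)%N (ltn_pmod k (isT : 0 < 3)%N).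
rewrite /= -divn_eq => {}sumE; rewrite -[LHS](mulfK q3) sumE /corr.
by case: eqP => // _; case: eqP => // _; rewrite opprD addrA.
Qed.

Theorem theorem3p2 (n k : nat) (K : fieldType)
    (hn : (3 <= n)%N) (hk : (1 <= k)%N) :
  exists r : int,
    regularity_quotient (edge_ideal K (semiregular_tree n k)) r /\
    (r%:~R : rat) =
      (let q : rat := n%:R - 1 in
       if (k %% 3 == 0)%N then
         (n%:R * q ^+ k.+1 - n%:R * q) / (q ^+ 3 - 1)
       else if (k %% 3 == 1)%N then
         (n%:R * q ^+ k.+1 - q ^+ 2 - 1) / (q ^+ 3 - 1)
       else
         (n%:R * q ^+ k.+1 - n%:R) / (q ^+ 3 - 1)).
Proof.
have n1 : (1 < n)%N by apply: ltnW.
have [r mr regr] := @forest_regularity K (semiregular_tree n k)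
  (fun v => size (word v)) setT (@tree_depth_forest n k).
exists r; split.
  apply: regularity_quotient_ext (fun p => iff_sym (edge_ideal_monomial p)) _.
  apply: has_regularity_quotient regr.
  exact/monomial_ideal_homogeneous/edge_monomial_up.
by rewrite (tree_matching_number n1 mr) card_centers // -level_sum_formula.
Qed.
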